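(* Let $L$ be a loop with Central-holomorph $H(L)$. Then $L$ is a homogeneous-SHL if and only if $H(L)$ is a homogeneous-SHL.
   Context: Mappings are written on the right, so $\alpha\beta$ means first $\alpha$, then $\beta$. For a loop $(L,\cdot)$ let $Aum(L,\cdot)$ be its automorphism group. The holomorph $H(L)=(H,\circ)$ is the loop on the set $H$ of pairs $(\alpha,x)$ with $\alpha\in Aum(L,\cdot)$, $x\in L$, with operation $(\alpha,x)\circ(\beta,y)=(\alpha\beta,\ x\beta\cdot y)$. The symbol $x^{-1}$ denotes the two-sided inverse of $x$ (assumed to exist in $L$). The nucleus $N(L)$ is the set of $a\in L$ with $a\cdot xy=ax\cdot y$, $x\cdot ay=xa\cdot y$, $x\cdot ya=xy\cdot a$ for all $x,y\in L$; the centrum $C(L)$ is the set of $a\in L$ with $ax=xa$ for all $x\in L$; the center is $Z(L)=N(L)\cap C(L)$. $H(L)$ is called a Central-holomorph of $L$ if $x^{-1}\cdot x\alpha\in Z(L)$ or $x\alpha\cdot x^{-1}\in Z(L)$ for all $x\in L$ and $\alpha\in Aum(L,\cdot)$. An A-loop is a loop all of whose inner mappings (the elements of the multiplication group, generated by all left and right translations, that fix the identity element) are automorphisms. A loop has the inverse property (IP) if every element $x$ has an inverse $x^{-1}$ such that $x^{-1}\cdot(x\cdot y)=y=(y\cdot x)\cdot x^{-1}$ for all $y$. A homogeneous loop is an A-loop with the IP. A loop is a Smarandache homogeneous loop (SHL) if it has at least one non-trivial subloop that is a homogeneous loop. A homogeneous-SHL is a loop that is both a homogeneous loop and a SHL.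 *)

(* Defs.v *)
From HB Require Import structures.
From mathcomp Require Import all_boot boolp classical_sets.

Set Implicit Arguments.
Unset Strict Implicit.
Unset Printing Implicit Defensive.

Local Open Scope classical_set_scope.
Local Open Scope group_scope.

HB.mixin Record UMagma_isLoop G of UMagma G := {
  loop_ldiv : forall a b : G, exists! x : G, a * x = b;
  loop_rdiv : forall a b : G, exists! y : G, y * a = b
}.

(* Through umagmaType the carrier is a choiceType, which classically is no
   restriction: gen_eqMixin and gen_choiceMixin apply to every type. *)
#[short(type="loopType")]
HB.structure Definition Loop := {G of UMagma_isLoop G & UMagma G}.

Definition is_aut (L : loopType) (f : L -> L) : Prop :=
  {morph f : x y / x * y} /\ bijective f.

Record aut (L : loopType) := Aut {
  aut_fun :> L -> L;
  autP : is_aut aut_fun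
}.

Lemma aut_eq (L : loopType) (f g : aut L) : f =1 g -> f = g.
Proof.
case: f g => [f fP] [g gP] /= /funext fg; case: _ / fg in gP *.
by congr Aut; exact: Prop_irrelevance.
Qed.

Lemma is_aut_id (L : loopType) : is_aut (@id L).
Proof. by split=> //; exists id. Qed.

Definition aut_id (L : loopType) : aut L := Aut (is_aut_id L).

Lemma is_aut_comp (L : loopType) (f g : aut L) : is_aut (g \o f).
Proof.
case: f g => [f [fM fB]] [g [gM gB]] /=; split; last exact: bij_comp.
by move=> x y /=; rewrite fM gM.
Qed.

(* Mappings act on the right in the source: [aut_comp f g] is the product
   "f, then g". *)
Definition aut_comp (L : loopType) (f g : aut L) : aut L :=
  Aut (is_aut_comp f g).

Lemma is_aut_inv (L : loopType) (f : aut L) (g : L -> L) :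
  cancel f g -> cancel g f -> is_aut g.
Proof.
case: f => f [fM fB] /= fK gK; split; last by exists f.
by move=> x y; rewrite -{1}(gK x) -{1}(gK y) -fM fK.
Qed.

Lemma aut_invP (L : loopType) (f : aut L) :
  exists g : aut L, cancel f g /\ cancel g f.
Proof.
have [_ [g fK gK]] := autP f.
by exists (Aut (is_aut_inv fK gK)).
Qed.

Definition holomorph (L : loopType) : Type := (aut L * L)%type.

Definition hol_mul (L : loopType) (u v : holomorph L) : holomorph L :=
  (aut_comp u.1 v.1, v.1 u.2 * v.2).

Definition hol_one (L : loopType) : holomorph L := (aut_id L, 1).

Lemma hol_mul1 (L : loopType) : left_id (hol_one L) (@hol_mul L).
Proof.
move=> [b y]; rewrite /hol_mul /=; congr pair; first exact: aut_eq.
have [bM [c bK cK]] := autP b.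
suff -> : b 1 = 1 by rewrite mul1g.
by rewrite -[RHS]cK -[c 1]mul1g bM cK mulg1.
Qed.

Lemma hol_mulr1 (L : loopType) : right_id (hol_one L) (@hol_mul L).
Proof.
by move=> [a x]; rewrite /hol_mul /= mulg1; congr pair; exact: aut_eq.
Qed.

Lemma hol_ldiv (L : loopType) (u w : holomorph L) :
  exists! v, hol_mul u v = w.
Proof.
case: u w => [a x] [c z]; have [a' [aK a'K]] := aut_invP a.
have [y [yE yU]] := loop_ldiv (c (a' x)) z.
exists (aut_comp a' c, y); split=> [|[b t]].
  by rewrite /hol_mul /= yE; congr pair; apply: aut_eq => s /=; rewrite aK.
rewrite /hol_mul /= => -[/(congr1 (@aut_fun L)) /= abc bE].
have bc : b = aut_comp a' c.
  by apply: aut_eq => s /=; rewrite -[in LHS](a'K s) -abc.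
by rewrite bc in bE *; congr pair; exact: yU.
Qed.

Lemma hol_rdiv (L : loopType) (u w : holomorph L) :
  exists! v, hol_mul v u = w.
Proof.
case: u w => [b y] [c z]; have [b' [bK b'K]] := aut_invP b.
have [x [xE xU]] := loop_rdiv y z.
exists (aut_comp c b', b' x); split=> [|[a t]].
  by rewrite /hol_mul /= b'K xE; congr pair; apply: aut_eq => s /=; rewrite b'K.
rewrite /hol_mul /= => -[/(congr1 (@aut_fun L)) /= abc tE].
congr pair; last by rewrite (xU _ tE) bK.
by apply: aut_eq => s /=; rewrite -abc /= bK.
Qed.

HB.instance Definition _ (L : loopType) := gen_eqMixin (holomorph L).
HB.instance Definition _ (L : loopType) := gen_choiceMixin (holomorph L).
HB.instance Definition _ (L : loopType) :=
  hasMul.Build (holomorph L) (@hol_mul L).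
HB.instance Definition _ (L : loopType) :=
  Magma_isUMagma.Build (holomorph L) (@hol_mul1 L) (@hol_mulr1 L).
HB.instance Definition _ (L : loopType) :=
  UMagma_isLoop.Build (holomorph L) (@hol_ldiv L) (@hol_rdiv L).

Definition nucleus (L : loopType) : set L :=
  [set a | forall x y : L,
     [/\ a * (x * y) = (a * x) * y,
         x * (a * y) = (x * a) * y &
         x * (y * a) = (x * y) * a]].

Definition centrum (L : loopType) : set L := [set a | forall x : L, a * x = x * a].

Definition center (L : loopType) : set L := @nucleus L `&` @centrum L.

Definition two_sided_inverse (L : loopType) (x x' : L) : Prop :=
  x * x' = 1 /\ x' * x = 1.

Definition has_two_sided_inverses (L : loopType) : Prop :=
  forall x : L, exists x' : L, two_sided_inverse x x'.

(* In a loop a two-sided inverse is unique, so x' is the inverse of x; this is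
   meant for loops in which every element has one. *)
Definition is_central_holomorph (L : loopType) : Prop :=
  forall (x x' : L) (f : aut L), two_sided_inverse x x' ->
    center (x' * f x) \/ center (f x * x').

(* The subgroup of Sym(L) generated by the translations. *)
Inductive mult_group (L : loopType) : (L -> L) -> Prop :=
| mult_id : mult_group id
| mult_left (a : L) : mult_group (fun x => a * x)
| mult_right (a : L) : mult_group (fun x => x * a)
| mult_comp (f g : L -> L) :
    mult_group f -> mult_group g -> mult_group (g \o f)
| mult_inv (f g : L -> L) :
    mult_group f -> cancel f g -> cancel g f -> mult_group g.

Definition inner_mapping (L : loopType) (f : L -> L) : Prop :=
  mult_group f /\ f 1 = 1.

Definition is_A_loop (L : loopType) : Prop :=
  forall f : L -> L, inner_mapping f -> is_aut f.

Definition has_IP (L : loopType) : Prop :=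
  forall x : L, exists x' : L, two_sided_inverse x x' /\
    forall y : L, x' * (x * y) = y /\ (y * x) * x' = y.

Definition is_homogeneous (L : loopType) : Prop := is_A_loop L /\ has_IP L.

(* The division axioms say that S contains the solutions of a * x = b and
   y * a = b whenever it contains a and b. *)
Record subloop (L : loopType) := Subloop {
  subloop_set :> L -> Prop;
  subloop1 : subloop_set 1;
  subloopM : forall x y, subloop_set x -> subloop_set y -> subloop_set (x * y);
  subloop_ldiv :
    forall a x, subloop_set a -> subloop_set (a * x) -> subloop_set x;
  subloop_rdiv :
    forall a y, subloop_set a -> subloop_set (y * a) -> subloop_set y
}.

Definition subloop_sort (L : loopType) (S : subloop L) : Type := {x : L | S x}.

Section SubloopLoop.
Variables (L : loopType) (S : subloop L).
Implicit Types u v w : subloop_sort S.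

Definition subloop_mul u v : subloop_sort S :=
  exist _ (sval u * sval v) (subloopM (svalP u) (svalP v)).

Definition subloop_one : subloop_sort S := exist _ 1 (subloop1 S).

Lemma subloop_eq u v : sval u = sval v -> u = v.
Proof.
case: u v => [x Sx] [y Sy] /= xy; case: _ / xy in Sy *.
by congr exist; exact: Prop_irrelevance.
Qed.

Lemma subloop_mul1 : left_id subloop_one subloop_mul.
Proof. by move=> u; apply: subloop_eq; rewrite /= mul1g. Qed.

Lemma subloop_mulr1 : right_id subloop_one subloop_mul.
Proof. by move=> u; apply: subloop_eq; rewrite /= mulg1. Qed.

Lemma subloop_ldivP u w : exists! v, subloop_mul u v = w.
Proof.
have [x [xE xU]] := loop_ldiv (sval u) (sval w).
have Sx : S x by apply: (subloop_ldiv (svalP u)); rewrite xE; exact: svalP.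
exists (exist _ x Sx); split=> [|v /(congr1 sval) vE]; apply: subloop_eq => //=.
exact: xU.
Qed.

Lemma subloop_rdivP u w : exists! v, subloop_mul v u = w.
Proof.
have [x [xE xU]] := loop_rdiv (sval u) (sval w).
have Sx : S x by apply: (subloop_rdiv (svalP u)); rewrite xE; exact: svalP.
exists (exist _ x Sx); split=> [|v /(congr1 sval) vE]; apply: subloop_eq => //=.
exact: xU.
Qed.

HB.instance Definition _ := gen_eqMixin (subloop_sort S).
HB.instance Definition _ := gen_choiceMixin (subloop_sort S).
HB.instance Definition _ := hasMul.Build (subloop_sort S) subloop_mul.
HB.instance Definition _ :=
  Magma_isUMagma.Build (subloop_sort S) subloop_mul1 subloop_mulr1.
HB.instance Definition _ :=
  UMagma_isLoop.Build (subloop_sort S) subloop_ldivP subloop_rdivP.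

End SubloopLoop.

(* Non-trivial means different from {1}; the whole loop is allowed. *)
Definition is_SHL (L : loopType) : Prop :=
  exists S : subloop L,
    (exists2 x, S x & x <> 1) /\ is_homogeneous (subloop_sort S : loopType).

Definition is_homogeneous_SHL (L : loopType) : Prop :=
  is_homogeneous L /\ is_SHL L.

(* Main.v *)
Require Import Defs.
From HB Require Import structures.
From mathcomp Require Import all_boot boolp classical_sets.

(** Since a homogeneous loop is a homogeneous subloop of itself, a homogeneous
    loop is an SHL exactly when it is non-trivial ([homogeneous_SHLP]), and
    H(L) is non-trivial exactly when L is. What remains is that L is
    homogeneous if and only if H(L) is.

    From H(L) to L: x |-> (id, x) embeds L into H(L). Along an embedding every
    element of the multiplication group of the small loop is the restriction
    of one of the large loop, so inner mappings of L are restrictions of inner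
    mappings of H(L), and homogeneity is inherited ([homogeneous_embed]).

    From L to H(L): the inverse property is a direct computation. For the
    A-loop property, let z_b(x) = x \ b(x) be the amount by which an
    automorphism b moves x. Centrality of the holomorph makes z_b a
    homomorphism from L to its center, and b |-> z_b(x) a crossed
    homomorphism. Functions being written on the left, every element of the
    multiplication group of H(L) then has the shape
      (b, y) |-> (n b m, n (f(y) z_b(x0)))
    for automorphisms m, n, some x0 in L and some f in the multiplication
    group of L ([mult_group_hol_affine]): translations have this shape, and
    it survives composition and inversion because f slides past central
    factors. If such a map fixes the identity, then m is the inverse of n and
    f(1) = 1. Hence f is inner, so it is an automorphism of L, and it commutes
    with every automorphism b because z_b(f(w)) = z_b(w)
    ([inner_aut_comm]). With the crossed homomorphism identity for z this
    makes the map multiplicative ([holomorph_A_loop]). *)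

Set Implicit Arguments.
Unset Strict Implicit.
Unset Printing Implicit Defensive.

Local Open Scope classical_set_scope.
Local Open Scope group_scope.

(** * Loops, multiplication groups and embeddings *)

Lemma loop_mulI (L : loopType) (a : L) : injective (mul a).
Proof.
move=> x y axy; have [z [_ zU]] := loop_ldiv a (a * x).
by rewrite -(zU x) // (zU y).
Qed.

Lemma loop_mulIr (L : loopType) (a : L) : injective (mul^~ a).
Proof.
move=> x y /= axy; have [z [_ zU]] := loop_rdiv a (x * a).
by rewrite -(zU x) // (zU y).
Qed.

Lemma morph_loop1 (M N : loopType) (i : M -> N) :
  {morph i : x y / x * y} -> i 1 = 1.
Proof. by move=> iM; apply: (@loop_mulI _ (i 1)); rewrite -iM !mulg1. Qed.

Lemma autM (L : loopType) (f : aut L) : {morph f : x y / x * y}.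
Proof. exact: (autP f).1. Qed.

Lemma aut1 (L : loopType) (f : aut L) : f 1 = 1.
Proof. exact: (morph_loop1 (autM f)). Qed.

Lemma mult_group_bij (L : loopType) (f : L -> L) : mult_group f -> bijective f.
Proof.
elim=> [|a|a|{}f g _ fB _ gB|{}f g _ _ fK gK].
- by exists id.
- have [h hP] := choice (loop_ldiv a).
  exists h => x; first by apply: (@loop_mulI _ a); exact: (hP _).1.
  exact: (hP x).1.
- have [h hP] := choice (loop_rdiv a).
  exists h => x; first by apply: (@loop_mulIr _ a); exact: (hP _).1.
  exact: (hP x).1.
- exact: bij_comp.
- by exists f.
Qed.

(** A word in translations by elements of [M] becomes a word in translations
    by their images. [F] is only some extension of [f]: it depends on the word
    chosen for [f]. *)
Lemma mult_group_extend (M N : loopType) (i : M -> N) (f : M -> M) :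
  {morph i : x y / x * y} -> mult_group f ->
  exists2 F : N -> N, mult_group F & forall x, F (i x) = i (f x).
Proof.
move=> iM; elim=> [|a|a|{}f g _ [F mF FE] _ [G mG GE]|{}f g _ [F mF FE] fK gK].
- by exists id => //; exact: mult_id.
- by exists (mul (i a)) => [|x]; [exact: mult_left | rewrite iM].
- by exists (mul^~ (i a)) => [|x]; [exact: mult_right | rewrite iM].
- by exists (G \o F) => [|x /=]; [exact: mult_comp | rewrite FE GE].
- have [G FK GK] := mult_group_bij mF.
  exists G; first exact: mult_inv FK GK.
  by move=> x; rewrite -[x in LHS]gK -FE FK.
Qed.

(** An inner mapping of [M] extends to a map that fixes the identity of [N],
    hence to an automorphism of [N], whose restriction is multiplicative. *)
Lemma homogeneous_embed (M N : loopType) (i : M -> N) :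
  {morph i : x y / x * y} -> injective i ->
  is_homogeneous N -> is_homogeneous M.
Proof.
move=> iM iI [NA NIP]; have i1 := morph_loop1 iM; split=> [f [mf f1]|x].
  have [F mF FE] := mult_group_extend iM mf.
  have [FM _] : is_aut F by apply: NA; split=> //; rewrite -i1 FE f1.
  split; last exact: mult_group_bij.
  by move=> x y; apply: iI; rewrite -FE !iM FM !FE.
have [y [[xy yx] yK]] := NIP (i x).
have [x' [xx' _]] := loop_ldiv x 1.
have ix' : i x' = y.
  by apply: (@loop_mulI _ (i x)); rewrite -iM xx' i1.
exists x'; split.
  by split=> //; apply: iI; rewrite iM ix' yx i1.
by move=> t; split; apply: iI; rewrite !iM ix'; case: (yK (i t)).
Qed.

Definition full_subloop (L : loopType) : subloop L :=
  @Subloop L (fun=> True) I (fun _ _ _ _ => I) (fun _ _ _ _ => I)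
    (fun _ _ _ _ => I).

(** The whole loop serves as the required homogeneous subloop; as the loop on
    its carrier is only isomorphic to [L], homogeneity passes to it along the
    inclusion. *)
Lemma homogeneous_SHLP (L : loopType) :
  is_homogeneous_SHL L <-> is_homogeneous L /\ exists x : L, x <> 1.
Proof.
split=> [[hL [S [[x _ xN1] _]]]|[hL [x xN1]]]; first by split=> //; exists x.
split=> //; exists (full_subloop L); split; first by exists x.
apply: (@homogeneous_embed (subloop_sort (full_subloop L)) L sval) => //.
by move=> u v; exact: subloop_eq.
Qed.

(** * The center of a loop *)

Lemma center_rassoc (L : loopType) (c x y : L) :
  center c -> x * (y * c) = (x * y) * c.
Proof. by case=> /(_ x y)[]. Qed.

Lemma center_comm (L : loopType) (c x : L) : center c -> c * x = x * c.
Proof. by case=> _; apply. Qed.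

Lemma center_mulAC (L : loopType) (c x y : L) :
  center c -> (x * c) * y = (x * y) * c.
Proof.
move=> Zc; have [/(_ x y)[_ E _] _] := Zc.
by rewrite -E (center_comm _ Zc) center_rassoc.
Qed.

Lemma center_mulACA (L : loopType) (x c y d : L) :
  center c -> center d -> (x * c) * (y * d) = (x * y) * (c * d).
Proof.
by move=> Zc Zd; rewrite center_mulAC // !center_rassoc // [RHS]center_mulAC.
Qed.

(** Once [c] commutes with everything, these two associativity laws imply the
    third one. *)
Lemma centerP (L : loopType) (c : L) :
  (forall x, c * x = x * c) -> (forall x y, x * (y * c) = (x * y) * c) ->
  (forall x y, (x * c) * y = (x * y) * c) -> center c.
Proof.
move=> cC cA cAC; split=> // x y; split; last exact: cA.
  by rewrite !cC cAC.
by rewrite cC cA cAC.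
Qed.

Lemma center1 (L : loopType) : center (1 : L).
Proof. by apply: centerP => *; rewrite ?mulg1 ?mul1g. Qed.

Lemma centerM (L : loopType) (c d : L) : center c -> center d -> center (c * d).
Proof.
move=> Zc Zd; apply: centerP => [x|x y|x y].
- by rewrite center_mulAC // (center_comm x Zc) center_rassoc.
- by rewrite !(center_rassoc _ _ Zd) (center_rassoc _ _ Zc).
- rewrite !(center_rassoc _ _ Zd).
  by rewrite (center_mulAC _ _ Zd) (center_mulAC _ _ Zc).
Qed.

Lemma center_aut (L : loopType) (f : aut L) (c : L) : center c -> center (f c).
Proof.
move=> Zc; have [g [_ gK]] := aut_invP f.
apply: centerP => [x|x y|x y].
- by rewrite -[x]gK -!(autM f) (center_comm _ Zc).
- by rewrite -[x]gK -[y]gK -!(autM f) (center_rassoc _ _ Zc).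
- by rewrite -[x]gK -[y]gK -!(autM f) (center_mulAC _ _ Zc).
Qed.

Lemma center_inv (L : loopType) (c : L) :
  center c -> exists2 d, center d & c * d = 1.
Proof.
move=> Zc; have [d [cd _]] := loop_ldiv c 1; exists d => //.
have dc : d * c = 1 by rewrite -(center_comm _ Zc).
apply: centerP => [x|x y|x y]; apply: (@loop_mulIr _ c) => /=.
- by rewrite -(center_mulAC _ _ Zc) dc mul1g -(center_rassoc _ _ Zc) dc mulg1.
- by rewrite -!(center_rassoc _ _ Zc) dc !mulg1.
- by rewrite -(center_mulAC _ _ Zc) -!(center_rassoc _ _ Zc) dc !mulg1.
Qed.

(** Translations commute with multiplication by a central element, and so does
    the group they generate. *)
Lemma mult_group_center (L : loopType) (f : L -> L) (c y : L) :
  center c -> mult_group f -> f (y * c) = f y * c.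
Proof.
move=> Zc mf; elim: mf y => [|a|a|{}f g _ fE _ gE|{}f g _ fE fK gK] y //=.
- exact: center_rassoc.
- exact: center_mulAC.
- by rewrite fE gE.
- by rewrite -[y in LHS]gK -fE fK.
Qed.

(** * The displacement of an element by an automorphism *)

(** The left quotient x \ f(x). In an inverse property loop it is
    x^-1 * f(x), but the quotient form makes sense in every loop. *)
Definition defect (L : loopType) (f : L -> L) (x : L) : L :=
  sval (cid (loop_ldiv x (f x))).

Lemma defectE (L : loopType) (f : L -> L) (x : L) : x * defect f x = f x.
Proof. by rewrite /defect; case: cid => c []. Qed.

Definition central_auts (L : loopType) : Prop :=
  forall (f : aut L) (x : L), center (defect f x).

(** The two alternatives in the definition of a central holomorph agree: if
    c = f(x) * x^-1 is central, then f(x) = c * x = x * c, so x^-1 * f(x) is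
    also c. *)
Lemma central_autsI (L : loopType) :
  has_IP L -> is_central_holomorph L -> central_auts L.
Proof.
move=> IP hc f x; have [x' [xx' x'K]] := IP x.
have x'f : x' * f x = defect f x.
  by rewrite -(defectE f x); case: (x'K (defect f x)).
have [|Zc] := hc x x' f xx'; first by rewrite x'f.
suff -> : defect f x = f x * x' by [].
apply: (@loop_mulI _ x); rewrite defectE -(center_comm x Zc).
apply: (@loop_mulIr _ x') => /=; by case: (x'K (f x * x')) => _ ->.
Qed.

Lemma defect1 (L : loopType) (f : aut L) : defect f 1 = 1.
Proof. by rewrite -[LHS]mul1g defectE aut1. Qed.

Lemma defect_id (L : loopType) (x : L) : defect (aut_id L) x = 1.
Proof. by apply: (@loop_mulI _ x); rewrite defectE mulg1. Qed.

Lemma defectM (L : loopType) (f : aut L) :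
  central_auts L -> {morph defect f : x y / x * y}.
Proof.
move=> Z x y; apply: (@loop_mulI _ (x * y)).
by rewrite defectE autM -center_mulACA // !defectE.
Qed.

(** For [m] the identity this is the crossed homomorphism identity. For general
    [m] it says that passing from [b] to n \o b \o m changes its defect, up to
    transport along [m] and [n], only by a factor that does not depend on
    [b]. *)
Lemma defect_comp (L : loopType) (m b n : aut L) (x : L) : central_auts L ->
  defect (aut_comp (aut_comp m b) n) x =
  defect (aut_comp m n) x * n (defect b (m x)).
Proof.
move=> Z; apply: (@loop_mulI _ x); rewrite defectE center_rassoc.
  by rewrite defectE /= -autM defectE.
exact: center_aut.
Qed.

(** [defect b] is a homomorphism into an abelian group, and a translation of
    the source becomes a translation of the target. *)
Lemma defect_mult_group (L : loopType) (b : aut L) (f : L -> L) :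
  central_auts L -> mult_group f ->
  exists2 d, center d & forall w, defect b (f w) = defect b w * d.
Proof.
move=> Z; elim=> [|a|a|{}f g _ [d Zd dE] _ [e Ze eE]|{}f g _ [d Zd dE] fK gK].
- by exists 1 => [|w]; [exact: center1 | rewrite mulg1].
- by exists (defect b a) => // w; rewrite defectM // center_comm.
- by exists (defect b a) => // w; rewrite defectM.
- exists (d * e) => [|w /=]; first exact: centerM.
  by rewrite eE dE -center_rassoc.
- have [e Ze de] := center_inv Zd; exists e => // w.
  by rewrite -[w in RHS]gK dE -center_rassoc // de mulg1.
Qed.

(** The constant by which [f] shifts [defect b] is read off at 1, where it is
    trivial; thus f(b(w)) = f(w * z) = f(w) * z = b(f(w)), with z the common
    value of [defect b] at [w] and at [f w]. *)
Lemma inner_aut_comm (L : loopType) (b : aut L) (f : L -> L) (w : L) :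
  central_auts L -> inner_mapping f -> f (b w) = b (f w).
Proof.
move=> Z [mf f1]; have [d _ dE] := defect_mult_group b Z mf.
have d1 : d = 1 by have := dE 1; rewrite f1 defect1 mul1g.
rewrite -(defectE b w) (mult_group_center _ (Z b w) mf).
by rewrite -(defectE b (f w)) dE d1 mulg1.
Qed.

(** [g] is the conjugate of [f] by [n], obtained by extending [f] along the
    inverse of [n] viewed as an embedding of [L] into itself. *)
Lemma mult_group_aut_conj (L : loopType) (n : aut L) (f : L -> L) :
  mult_group f -> exists2 g, mult_group g & forall y, f (n y) = n (g y).
Proof.
move=> mf; have [n' [nK n'K]] := aut_invP n.
have [g mg gE] := mult_group_extend (autM n') mf.
by exists g => // y; rewrite -[y in RHS]nK gE n'K.
Qed.

(** * The multiplication group of the holomorph *)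

(** The shape shared by all elements of the multiplication group of the
    holomorph. Applying [n] outside and taking the defect of [b] itself, rather
    than of its image [n \o b \o m], is what makes composition multiply the
    [x0] parameters up to an automorphism. *)
Definition hol_affine (L : loopType) (F : holomorph L -> holomorph L) : Prop :=
  exists (m n : aut L) (f : L -> L) (x0 : L), mult_group f /\
    forall b y, F (b, y) =
      (aut_comp (aut_comp m b) n, n (f y * defect b x0)).

(** [defect_comp] rewrites the defect that [G] takes of [n \o b \o m] as a
    constant [c] times a defect of [b]; the constant is absorbed in the
    multiplication group of [L], the defect of [b] in [x0]. *)
Lemma hol_affine_comp (L : loopType) (F G : holomorph L -> holomorph L) :
  central_auts L -> hol_affine F -> hol_affine G -> hol_affine (G \o F).
Proof.
move=> Z [m [n [f [x [mf FE]]]]] [m1 [n1 [g [x1 [mg GE]]]]].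
have [g2 mg2 g2E] := mult_group_aut_conj n mg.
have [n' [nK n'K]] := aut_invP n.
pose c := n' (defect (aut_comp m n) x1).
have Zc : center c by exact: center_aut.
exists (aut_comp m1 m), (aut_comp n n1), (fun y => g2 (f y) * c), (x * m x1).
split; first exact: mult_comp (mult_comp mf mg2) (mult_right c).
move=> b y /=; rewrite FE GE; congr pair; first exact: aut_eq.
rewrite /=; congr (n1 _).
rewrite g2E (mult_group_center _ (Z b x) mg2) defect_comp //.
rewrite -[defect (aut_comp m n) x1]n'K -/c -!autM defectM //.
by rewrite center_mulACA.
Qed.

(** Solving F(b, y) = (b', y') for y replaces f by its inverse and x0 by an
    inverse of x0, since [defect b] is a homomorphism; [defect_comp] then
    expresses the result in terms of b'. *)
Lemma hol_affine_inv (L : loopType) (F G : holomorph L -> holomorph L) :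
  central_auts L -> hol_affine F -> cancel F G -> cancel G F -> hol_affine G.
Proof.
move=> Z [m [n [f [x [mf FE]]]]] FK GK.
have [g fK gK] := mult_group_bij mf; have mg := mult_inv mf fK gK.
have [m' [mK m'K]] := aut_invP m; have [n' [nK n'K]] := aut_invP n.
have [g2 mg2 g2E] := mult_group_aut_conj n' mg.
have [x' [xx' _]] := loop_ldiv x 1.
have inv_def (b : aut L) : defect b x' * defect b x = 1.
  by rewrite -center_comm // -defectM // xx' defect1.
pose c := n (defect (aut_comp m' n') x').
have Zc : center c by exact: center_aut.
exists m', n', (fun y => g2 y * c), (m' x').
split; first exact: mult_comp mg2 (mult_right c).
move=> b y; apply: (can_inj FK); rewrite GK FE; congr pair.
  by apply: aut_eq => t /=; rewrite mK n'K.
rewrite -(center_rassoc _ _ (Z b (m' x'))) !(autM n') -g2E /c nK.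
rewrite -defect_comp // (mult_group_center _ (Z _ _) mf) gK.
by rewrite -(center_rassoc _ _ (Z _ x)) inv_def mulg1 n'K.
Qed.

(** For the left translation by (a, x), b(x) * y = (x * z) * y = (x * y) * z
    with z the defect of b at x, so x0 = x. The right translation sends y to
    a(y) * x = a(y * a^-1(x)), whence the translation by a^-1(x) and x0 = 1. *)
Lemma mult_group_hol_affine (L : loopType) (F : holomorph L -> holomorph L) :
  central_auts L -> mult_group (L := holomorph L) F -> hol_affine F.
Proof.
move=> Z; elim=> [|[a x]|[a x]|{}F G _ FA _ GA|{}F G _ FA FK GK].
- exists (aut_id L), (aut_id L), id, 1; split; first exact: mult_id.
  by move=> b y; rewrite defect1 mulg1; congr pair; exact: aut_eq.
- exists a, (aut_id L), (mul x), x; split; first exact: mult_left.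
  move=> b y; congr pair; first exact: aut_eq.
  by rewrite /= -center_mulAC // defectE.
- have [a' [aK a'K]] := aut_invP a.
  exists (aut_id L), a, (mul^~ (a' x)), 1; split; first exact: mult_right.
  move=> b y; congr pair; first exact: aut_eq.
  by rewrite defect1 mulg1 autM a'K.
- exact: hol_affine_comp.
- exact: hol_affine_inv FK GK.
Qed.

(** An inner mapping of the holomorph is
    (b, y) |-> (n b n^-1, n (f(y) z_b(x0))) with f an inner mapping of [L]. It
    is multiplicative because f is, because f commutes with automorphisms, and
    because b |-> z_b(x0) is a crossed homomorphism. *)
Lemma holomorph_A_loop (L : loopType) :
  central_auts L -> is_A_loop L -> is_A_loop (holomorph L).
Proof.
move=> Z LA F [mF F1]; split; last exact: mult_group_bij.
have [m [n [f [x [mf FE]]]]] := mult_group_hol_affine Z mF.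
have [mn nf1] : aut_comp (aut_comp m (aut_id L)) n = aut_id L /\
    n (f 1 * defect (aut_id L) x) = 1.
  have := F1; rewrite [F _]FE => F1E.
  by split; [have := congr1 fst F1E | have := congr1 snd F1E].
have nm t : n (m t) = t by exact: (congr1 (fun h : aut L => h t) mn).
have f1 : f 1 = 1.
  by apply: (bij_inj (autP n).2); rewrite aut1 -[RHS]nf1 defect_id mulg1.
have [n' [nK n'K]] := aut_invP n.
have mE t : m t = n' t by rewrite -(nK (m t)) nm.
have inner_f : inner_mapping f by [].
have [fM _] := LA _ inner_f.
move=> [b y] [b' y']; rewrite [LHS]FE !FE; congr pair.
  by apply: aut_eq => t /=; rewrite !mE nK.
rewrite /= mE nK -autM; congr (n _).
have zE : defect (b' \o b) x = defect b' x * b' (defect b x).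
  exact: (defect_comp (aut_id L) b b' x Z).
have Zb : center (b' (defect b x)) by exact: center_aut.
rewrite fM (inner_aut_comm b' y Z inner_f) (autM b') zE.
by rewrite (center_mulACA _ _ Zb (Z b' x)) (center_comm _ Zb).
Qed.

Lemma holomorph_IP (L : loopType) : has_IP L -> has_IP (holomorph L).
Proof.
move=> IP [a x]; have [a' [aK a'K]] := aut_invP a.
have [x' [[xx' x'x] x'K]] := IP x.
exists (a', a' x'); split=> [|[b y]]; split.
- congr pair; first by apply: aut_eq => t /=; rewrite aK.
  by rewrite /= -autM xx' aut1.
- congr pair; first by apply: aut_eq => t /=; rewrite a'K.
  by rewrite /= a'K.
- congr pair; first by apply: aut_eq => t /=; rewrite a'K.
  (* Writing y as b(c(y)) pulls b out of the whole product. *)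
  have [c [bK cK]] := aut_invP b.
  rewrite /= a'K -{1 2}(cK y) -[b x * _]autM -autM.
  by case: (x'K (c y)) => -> _.
- congr pair; first by apply: aut_eq => t /=; rewrite aK.
  by rewrite /= -autM; case: (x'K (a y)) => _ ->; rewrite aK.
Qed.

Lemma holomorph_nontrivial (L : loopType) :
  (exists u : holomorph L, u <> 1) <-> exists x : L, x <> 1.
Proof.
split=> [[[a x] uN1]|[x xN1]]; last by exists (aut_id L, x) => -[].
apply: contrapT => /forallNP L1; apply: uN1.
have {}L1 t : t = 1 :> L by exact: contrapT.
congr pair; last exact: L1.
by apply: aut_eq => t; rewrite [LHS]L1 [RHS]L1.
Qed.

(** * Homogeneity of a loop and of its holomorph *)

Theorem corollary3p5 (L : loopType)
  (hinv : has_two_sided_inverses L)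
  (hcentral : is_central_holomorph L) :
  is_homogeneous_SHL L <-> is_homogeneous_SHL (holomorph L : loopType).
Proof.
rewrite !homogeneous_SHLP holomorph_nontrivial.
split=> -[hom nontriv]; split=> //.
  have [LA IP] := hom; split; last exact: holomorph_IP.
  by apply: holomorph_A_loop => //; exact: central_autsI.
apply: (@homogeneous_embed L (holomorph L) (pair (aut_id L))) hom.
  by move=> x y; congr pair; exact: aut_eq.
by move=> x y [].
Qed.
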